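(* Let $x,y,m,n$ be non-negative integers, let $1\le a_1<a_2<\dots<a_m\le m+n$ and $1\le b_1<b_2<\dots<b_n\le m+n$ be integers, and write $\mathbf{a}=(a_i)_{i=1}^m$, $\mathbf{b}=(b_j)_{j=1}^n$. If the region $S_{x}(\mathbf{a};\mathbf{b})$ admits a lozenge tiling, then \[ \frac{\operatorname{M}(S_{x}(\mathbf{a};\mathbf{b}))}{\operatorname{M}(S_{y}(\mathbf{a};\mathbf{b}))} =q^{(y-x)\left(\sum_{i=1}^{m}a_i+\sum_{j=1}^{n}b_j-\frac{(m+n)(m+n+1)}{2}\right)}\frac{\operatorname{PP}_{q^2}(y,m,n)}{\operatorname{PP}_{q^2}(x,m,n)} \prod_{i=1}^{m}\frac{(-q^{2(x+i)};q^2)_{a_i-i}}{(-q^{2(y+i)};q^2)_{a_i-i}}\prod_{j=1}^{n}\frac{(-q^{2(x+j)};q^2)_{b_j-j}}{(-q^{2(y+j)};q^2)_{b_j-j}}. \]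
   Context: Work on the triangular lattice with unit side length and horizontal lattice lines. A lozenge is the union of two unit triangles sharing an edge; a vertical lozenge is one whose two triangles share a horizontal edge (an up-pointing triangle on top of a down-pointing triangle); its center is the midpoint of that horizontal edge. A tiling of a region is a covering by lozenges without gaps or overlaps. For a region whose lozenges carry weights, the weight of a tiling is the product of the weights of its lozenges, and $\operatorname{M}(R)$ denotes the sum of the weights of all tilings of $R$ (it is $0$ if $R$ has no tiling, and $1$ if $R$ is degenerate/empty). The region $S_x(\mathbf{a};\mathbf{b})$: start with the trapezoid whose top side is horizontal of length $x$, whose base is horizontal of length $x+m+n$, and whose left and right sides have length $m+n$ and make $60^\circ$ angles with the base. It consists of $m+n$ horizontal rows of unit triangles, numbered $1,\dots,m+n$ from top to bottom; in each row the leftmost and rightmost unit triangles are up-pointing. Remove the leftmost unit triangle of rows $a_1,\dots,a_m$ and the rightmost unit triangle of rows $b_1,\dots,b_n$. Weights: let $X,Y,q$ be indeterminates; for a point, let $i$ be twice its signed horizontal distance from the midpoint of the base (positive to the right). A vertical lozenge whose center has coordinate $i$ gets weight $\frac{Xq^{i}+Yq^{-i}}{2}$; all other lozenges have weight $1$. Notation: $(z;p)_k:=\prod_{l=0}^{k-1}(1+zp^{l})$ for integers $k\ge 0$ (note the plus sign). $\operatorname{PP}_q(a,b,c)=\prod_{i=1}^{a}\prod_{j=1}^{b}\prod_{k=1}^{c}\frac{q^{i+j+k-1}-1}{q^{i+j+k-2}-1}$. *)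

(* Defs.v *)
From HB Require Import structures.
From mathcomp Require Import all_boot all_order all_algebra.
From mathcomp Require Import fraction.
From mathcomp Require Import mpoly.

Set Implicit Arguments.
Unset Strict Implicit.
Unset Printing Implicit Defensive.

Import GRing.Theory.
Local Open Scope ring_scope.

(* In the trapezoid with top side [x] and [N] rows, the unit triangles of a
   row are numbered 0, 1, 2, ... from left to right; they alternate between
   up-pointing (even) and down-pointing (odd).  The [r]-th row from the top,
   [1 <= r <= N], has [x + r] up-pointing and [x + r - 1] down-pointing
   triangles, so its positions are [0 .. 2(x + r - 1)].
   [tri x N] is a bounding box for these (row, position) pairs; the triangles
   that really lie in the trapezoid are those of the set [trapezoid]. *)

Definition tri (x N : nat) : finType := ('I_N * 'I_((x + N).*2))%type.

Definition trow (x N : nat) (t : tri x N) : nat := (nat_of_ord t.1).+1.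
Definition tpos (x N : nat) (t : tri x N) : nat := nat_of_ord t.2.
Definition last_tpos (x N : nat) (t : tri x N) : nat := (x + trow t).-1.*2.

Definition is_up (x N : nat) (t : tri x N) : bool := ~~ odd (tpos t).

(* Twice the signed horizontal distance, from the midpoint of the base, of the
   vertical symmetry axis of [t]: consecutive triangles of a row have axes at
   distance 1/2, and the middle triangle of each row, at position x + r - 1,
   has its axis through the midpoint of the base. *)
Definition axis (x N : nat) (t : tri x N) : int :=
  (tpos t)%:Z - (x + trow t).-1%:Z.

Definition trapezoid (x N : nat) : {set tri x N} :=
  [set t | (tpos t <= last_tpos t)%N].

Definition region (x m n : nat) (a : 'I_m -> nat) (b : 'I_n -> nat) :
    {set tri x (m + n)} :=
  [set t in trapezoid x (m + n) |
     ~~ ((trow t \in codom a) && (tpos t == 0%N)) &&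
     ~~ ((trow t \in codom b) && (tpos t == last_tpos t))].

(* [s] and [t] share a horizontal edge, [s] being above [t]; the midpoint of
   that edge lies on the common vertical axis of [s] and [t]. *)
Definition vertical (x N : nat) (s t : tri x N) : bool :=
  [&& is_up s, ~~ is_up t, trow t == (trow s).+1 & axis t == axis s].

(* [s] and [t] share a non-horizontal edge, [s] being to the left of [t]. *)
Definition slanted (x N : nat) (s t : tri x N) : bool :=
  (trow t == trow s) && (tpos t == (tpos s).+1).

Definition lozenge (x N : nat) (L : {set tri x N}) : bool :=
  [exists s, exists t, (vertical s t || slanted s t) && (L == [set s; t])].

Definition tiling (x N : nat) (R : {set tri x N}) (P : {set {set tri x N}}) :
    bool :=
  partition P R && [forall L in P, lozenge L].

Definition tileable (x N : nat) (R : {set tri x N}) : bool :=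
  [exists P, tiling R P].

Definition lozenge_weight (F : fieldType) (X Y q : F) (x N : nat)
    (L : {set tri x N}) : F :=
  if [pick s | [exists t, vertical s t && (L == [set s; t])]] is Some s
  then (X * q ^ axis s + Y * q ^ (- axis s)) / 2%:R
  else 1.

Definition M (F : fieldType) (X Y q : F) (x N : nat) (R : {set tri x N}) : F :=
  \sum_(P | tiling R P) \prod_(L in P) lozenge_weight X Y q L.

Definition qpoch (F : fieldType) (z p : F) (k : nat) : F :=
  \prod_(0 <= l < k) (1 + z * p ^+ l).

Definition PP (F : fieldType) (q : F) (a b c : nat) : F :=
  \prod_(1 <= i < a.+1) \prod_(1 <= j < b.+1) \prod_(1 <= k < c.+1)
    ((q ^+ (i + j + k - 1) - 1) / (q ^+ (i + j + k - 2) - 1)).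

Definition ratfun : fieldType := {fraction {mpoly rat[3]}}.

Definition indet (i : nat) : ratfun :=
  FracField.tofrac ('X_(inord i) : {mpoly rat[3]}).

Definition Xvar : ratfun := indet 0.
Definition Yvar : ratfun := indet 1.
Definition qvar : ratfun := indet 2.

(* Main.v *)
Require Import Defs.
From mathcomp Require Import all_boot all_order all_algebra.
From mathcomp Require Import fraction mpoly zify ring.

Set Implicit Arguments.
Unset Strict Implicit.
Unset Printing Implicit Defensive.

Import Order.TTheory GRing.Theory Num.Theory.

Local Open Scope ring_scope.

(* Follow the lozenges through their sides parallel to the right side of the
   trapezoid: a tiling becomes a family of m nonintersecting lattice paths from
   the left dents, in rows a_i, to the undented unit segments of the right
   side, in rows c_j (the complement of b).  Hence M(S_x(a;b)) is the
   determinant of the path generating functions, which have the closed form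

     q^(-(x+c-1)(a-c)) [x+a-1 choose a-c]_{q^2} prod_{0 <= l < a-c} w(-l),

   with w(i) = (X q^i + Y q^-i)/2.  The product does not involve x, so x enters
   the determinant only through row and column factors, which give the ratio.
   The determinant formula is proved without path systems, by removing the
   triangles one by one: a forced lozenge leaves the determinant unchanged, and
   the choice between two lozenges expands one of its rows. *)

(** * Peeling off one triangle *)

Section Peeling.
Variables (F : fieldType) (X Y q : F) (x N : nat).
Implicit Types (R : {set tri x N}) (P : {set {set tri x N}}) (s t : tri x N).

Lemma M_set0 : M X Y q (set0 : {set tri x N}) = 1.
Proof.
rewrite /M (big_pred1 set0) ?big_set0 // => P; rewrite /tiling partition_set0 /=.
by case: eqP => //= ->; apply/forall_inP => L; rewrite inE.
Qed.

(** Adding [L] is a bijection between the tilings of [R :\: L] and the tilings of [R] that use [L].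
    The condition [L \notin P] makes [P] recoverable from [L |: P]. *)
Lemma tiling_setU1 R P L : lozenge L -> L \subset R ->
  (tiling R (L |: P) && (L \notin P)) = tiling (R :\: L) P.
Proof.
move=> lozL LR; rewrite /tiling; apply/idP/idP.
  case/andP=> /andP[partLP /forall_inP loz] LP.
  have -> : P = (L |: P) :\ L by rewrite setU1K.
  apply/andP; split.
    rewrite /partition; case/and3P: (partLP) => /eqP <- triv ne0.
    apply/and3P; split; last by rewrite inE negb_and negbK ne0 orbT.
      rewrite setU1K // /cover big_setU1 //= setDUl setDv set0U.
      apply/eqP/setP=> t; rewrite inE; case: bigcupP => [[K KP tK]|]; last by rewrite andbF.
      rewrite andbT; symmetry; apply/negP => tL; move/trivIsetP: triv => /(_ L K).
      rewrite !inE eqxx KP orbT => /(_ isT isT).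
      have -> : L != K by apply: contraNneq LP => ->.
      by move=> /(_ isT); rewrite disjoint_subset => /subsetP/(_ t tL); rewrite inE tK.
    by apply: trivIsetS triv; apply: subsetDl.
  by apply/forall_inP => K; rewrite !inE => /andP[_ ?]; apply: loz; rewrite !inE.
case/andP=> /and3P[/eqP covP triv ne0] /forall_inP loz.
have Lne : L != set0.
  by case/existsP: lozL => s /existsP[t /andP[_ /eqP ->]]; apply/set0Pn; exists s;
     rewrite !inE eqxx.
have disjL K : K \in P -> [disjoint L & K].
  move=> KP; rewrite disjoint_sym disjoint_subset; apply/subsetP => t tK.
  have : t \in cover P by apply/bigcupP; exists K.
  by rewrite covP !inE => /andP[].
have LP : L \notin P.
  by apply/negP => /disjL; rewrite -setI_eq0 setIid (negPf Lne).
rewrite LP andbT; apply/andP; split.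
  apply/and3P; split.
  - rewrite /cover big_setU1 //= -/(cover P) covP; apply/eqP/setP => t; rewrite !inE.
    by case: (boolP (t \in L)) => //= /(subsetP LR) ->.
  - apply/trivIsetP => A B; rewrite !inE => /orP[/eqP->|AP] /orP[/eqP->|BP].
    + by rewrite eqxx.
    + by move=> _; apply: disjL.
    + by move=> _; rewrite disjoint_sym; apply: disjL.
    + exact: (trivIsetP triv).
  - by rewrite !inE negb_or eq_sym Lne.
by apply/forall_inP => K; rewrite !inE => /orP[/eqP->|/loz].
Qed.

(** The tilings are grouped by the block that covers [t]. *)
Lemma M_peel R t : t \in R ->
  M X Y q R = \sum_(L | [&& lozenge L, t \in L & L \subset R])
                lozenge_weight X Y q L * M X Y q (R :\: L).
Proof.
move=> tR.
rewrite /M (partition_big (fun P => pblock P t)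
   (fun L => [&& lozenge L, t \in L & L \subset R])) /=; last first.
  move=> P /andP[partP /forall_inP loz]; have covP := cover_partition partP.
  have tc : t \in cover P by rewrite covP.
  rewrite mem_pblock tc (loz _ (pblock_mem tc)) /= -covP.
  by rewrite /cover; apply: (bigcup_max _ (pblock_mem tc)).
apply: eq_bigr => L /and3P[lozL tL LR].
rewrite (reindex_onto (fun P => L |: P) (fun P => P :\ L)) /=; last first.
  move=> P /andP[/andP[partP _] /eqP <-]; apply: setD1K; apply: pblock_mem.
  by rewrite (cover_partition partP).
have E P : (tiling R (L |: P) && (pblock (L |: P) t == L) && ((L |: P) :\ L == P))
           = tiling (R :\: L) P.
  rewrite -(tiling_setU1 P lozL LR); case til: (tiling R _) => //=.
  have -> : pblock (L |: P) t == L.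
    case/andP: til => /and3P[_ triv _] _; apply/eqP/def_pblock => //.
    by rewrite !inE eqxx.
  apply/eqP/idP => [<-|LP]; [by rewrite !inE eqxx | exact: setU1K].
rewrite (eq_bigl _ _ E) big_distrr /=; apply: eq_bigr => P.
by rewrite -(tiling_setU1 P lozL LR) => /andP[_ LP]; rewrite big_setU1.
Qed.

Definition adjacent s t : bool :=
  [|| vertical s t, slanted s t, vertical t s | slanted t s].

Lemma lozenge_pair s t : adjacent s t -> lozenge [set s; t].
Proof.
move=> st; have [|] : (vertical s t || slanted s t) \/ (vertical t s || slanted t s).
    by case/or4P: st => ->; rewrite ?orbT; auto.
  by move=> E; apply/existsP; exists s; apply/existsP; exists t; rewrite E eqxx.
by move=> E; apply/existsP; exists t; apply/existsP; exists s; rewrite E setUC eqxx.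
Qed.

Lemma lozengeP L t : lozenge L -> t \in L -> exists2 s, adjacent t s & L = [set t; s].
Proof.
case/existsP=> s /existsP[s' /andP[st /eqP ->]]; rewrite !inE => /orP[/eqP->|/eqP->].
  by exists s' => //; rewrite /adjacent; case/orP: st => ->; rewrite ?orbT.
by exists s; rewrite 1?setUC // /adjacent; case/orP: st => ->; rewrite ?orbT.
Qed.

Lemma adjacent_neq s t : adjacent s t -> s != t.
Proof.
move=> st; apply/eqP => est; move: st; rewrite est /adjacent /vertical /slanted.
by rewrite andbCA; case: (is_up t) => /=; rewrite ?eqxx /=; lia.
Qed.

(** A lozenge containing [t] is determined by its second triangle, so the sum over lozenges becomes
    a sum over neighbours of [t]. *)
Lemma M_peel_adjacent R t : t \in R ->
  M X Y q R = \sum_(s | adjacent t s && (s \in R))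
                lozenge_weight X Y q [set t; s] * M X Y q (R :\: [set t; s]).
Proof.
move=> tR; rewrite (M_peel tR).
(* The default [t] never arises for a lozenge, since its two triangles are distinct. *)
pose other (L : {set tri x N}) := odflt t [pick s in L :\ t].
have otherE s : adjacent t s -> other [set t; s] = s.
  move/adjacent_neq => ts; rewrite /other.
  have -> : [set t; s] :\ t = [set s].
    by apply/setP => u; rewrite !inE; case: eqP => //= ->; rewrite (negPf ts).
  by case: pickP => [u /set1P //|/(_ s)]; rewrite inE eqxx.
rewrite (reindex_onto (fun s => [set t; s]) other) /=; last first.
  by move=> L /and3P[lozL tL _]; have [s ts ->] := lozengeP lozL tL; rewrite otherE.
apply: eq_bigl => s; rewrite subUset !sub1set tR !inE eqxx /=.
apply/idP/idP => [/andP[/andP[lozL sR]] /eqP os|/andP[ts sR]].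
  rewrite sR andbT; have /(lozengeP lozL) : t \in [set t; s] by rewrite !inE eqxx.
  by case=> s' ts' E; move: os; rewrite E otherE // => <-.
by rewrite lozenge_pair // sR otherE // eqxx.
Qed.

Lemma lozenge_weight_slanted s t : slanted s t -> lozenge_weight X Y q [set s; t] = 1.
Proof.
case/andP=> /eqP row _; rewrite /lozenge_weight; case: pickP => // u.
case/existsP=> v /andP[/and4P[_ _ /eqP rv _] /eqP E].
have := set21 u v; have := set22 u v; rewrite -E !inE.
by case/orP=> /eqP vE; case/orP => /eqP uE; move: rv row; rewrite vE uE; lia.
Qed.

Lemma lozenge_weight_vertical s t : vertical s t ->
  lozenge_weight X Y q [set s; t] = (X * q ^ axis s + Y * q ^ (- axis s)) / 2%:R.
Proof.
move=> st; rewrite /lozenge_weight; case: pickP => [u|/(_ s)]; last first.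
  by case/existsP; exists t; rewrite st eqxx.
case/existsP=> v /andP[/and4P[_ _ /eqP rv /eqP av] /eqP E].
case/and4P: (st) => _ _ /eqP row /eqP ax.
have := set21 u v; have := set22 u v; rewrite -E !inE.
by case/orP=> /eqP vE; case/orP => /eqP uE; move: rv row av ax; rewrite vE uE => //; lia.
Qed.
End Peeling.

(** * Path generating functions *)

Section PathWeights.
Variables (F : fieldType) (X Y q : F).
Hypothesis q_neq0 : q != 0.
Hypothesis q_free : forall k, (0 < k)%N -> q ^+ k != 1.

Definition wt (i : int) : F := (X * q ^ i + Y * q ^ (- i)) / 2%:R.

(** The classical $(q^2;q^2)_k$ with minus signs; quotients of three of these are Gaussian binomials
    in base $q^2$. *)
Definition qfact (k : nat) : F := \prod_(l < k) (1 - (q ^+ 2) ^+ l.+1).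

Lemma qfact0 : qfact 0 = 1.
Proof. by rewrite /qfact big_ord0. Qed.

Lemma qfactS k : qfact k.+1 = qfact k * (1 - (q ^+ 2) ^+ k.+1).
Proof. by rewrite /qfact big_ord_recr. Qed.

Lemma qfact_factor_neq0 k : 1 - (q ^+ 2) ^+ k.+1 != 0.
Proof. by rewrite subr_eq0 eq_sym -exprM q_free. Qed.

Lemma qfact_neq0 k : qfact k != 0.
Proof. by apply/prodf_neq0 => l _; apply: qfact_factor_neq0. Qed.

(* Generating function of the paths with [h] horizontal and [v] vertical
   steps starting on the vertical axis [A]. *)
Definition path_weight (h v : nat) (A : int) : F :=
  qfact (h + v) / (qfact h * qfact v) / q ^+ (h * v) *
  \prod_(l < v) wt (A + (h + l)%N%:Z).

Lemma path_weight0 h A : path_weight h 0 A = 1.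
Proof.
by rewrite /path_weight big_ord0 addn0 muln0 qfact0 !mulr1 divr1 divff // qfact_neq0.
Qed.

Lemma path_weight_vertical v A :
  path_weight 0 v.+1 A = wt A * path_weight 0 v (A + 1).
Proof.
have E k B : path_weight 0 k B = \prod_(l < k) wt (B + l%:Z).
  by rewrite /path_weight mul0n qfact0 mul1r divff ?qfact_neq0 // divr1 mul1r.
rewrite !E big_ord_recl addr0; congr (_ * _); apply: eq_bigr => l _.
by congr wt; rewrite /= /bump /=; lia.
Qed.

(** This is the path recursion after cancelling common factors: it plays the part of the q-Pascal
    rule in the presence of the weights [wt]. *)
Lemma wt_balance (h v : nat) A :
  q ^+ h * (1 - (q ^+ 2) ^+ v) * wt A
  + q ^+ v * (1 - (q ^+ 2) ^+ h) * wt (A + (h + v)%N%:Z)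
  = (1 - (q ^+ 2) ^+ (h + v)) * wt (A + h%:Z).
Proof.
rewrite /wt !opprD !expfzDr // -!exprM -!invr_expz -!exprnP !(mulnC 2) !exprM !exprD.
have := expf_neq0 h q_neq0; have := expf_neq0 v q_neq0; have := expfz_neq0 A q_neq0.
move: 2%:R^-1 (q ^+ h) (q ^+ v) (q ^ A) => half qh qv qA nA nv nh.
by field; rewrite nA nv nh.
Qed.

(** Split by the first step. A horizontal step moves the axis by 2 at no cost; a vertical step moves
    it by 1 and uses a vertical lozenge of weight [wt A]. *)
Lemma path_weightS h v A :
  path_weight h.+1 v.+1 A =
  path_weight h v.+1 (A + 2) + wt A * path_weight h.+1 v (A + 1).
Proof.
rewrite /path_weight.
(* [P] is the product common to all three path weights. *)
set P := \prod_(l < v) wt (A + (h.+2 + l)%N%:Z).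
have -> : \prod_(l < v.+1) wt (A + (h.+1 + l)%N%:Z) = wt (A + h.+1%:Z) * P.
  rewrite big_ord_recl addn0; congr (_ * _); apply: eq_bigr => l _.
  by congr wt; rewrite /= /bump /=; lia.
have -> : \prod_(l < v.+1) wt (A + 2 + (h + l)%N%:Z) = P * wt (A + (h.+1 + v.+1)%N%:Z).
  rewrite big_ord_recr /=; congr (_ * _); last by congr wt; lia.
  by apply: eq_bigr => l _; congr wt; lia.
have -> : \prod_(l < v) wt (A + 1 + (h.+1 + l)%N%:Z) = P.
  by apply: eq_bigr => l _; congr wt; lia.
have B := wt_balance h.+1 v.+1 A.
rewrite [qfact (h.+1 + v.+1)](_ : _ = qfact (h.+1 + v) * (1 - (q ^+ 2) ^+ (h.+1 + v.+1)));
  last by rewrite addnS qfactS.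
rewrite [(h + v.+1)%N]addnS -addSn !(qfactS h) !(qfactS v).
have -> : q ^+ (h.+1 * v.+1) = q ^+ (h * v) * q ^+ h * q ^+ v.+1.
  by rewrite -!exprD; congr (_ ^+ _); lia.
have -> : q ^+ (h * v.+1) = q ^+ (h * v) * q ^+ h.
  by rewrite -!exprD; congr (_ ^+ _); lia.
have -> : q ^+ (h.+1 * v) = q ^+ (h * v) * q ^+ v.
  by rewrite -!exprD; congr (_ ^+ _); lia.
move: B; have := qfact_factor_neq0 h; have := qfact_factor_neq0 v.
have := qfact_neq0 h; have := qfact_neq0 v.
have := qfact_factor_neq0 (h + v).+1; rewrite -addnS -addSn.
have := expf_neq0 (h * v)%N q_neq0; have := expf_neq0 h q_neq0; have := expf_neq0 v q_neq0.
rewrite !(exprS q h) !(exprS q v).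
move: (1 - _ ^+ h.+1 : F) (1 - _ ^+ v.+1 : F) (1 - _ ^+ (h.+1 + v.+1) : F).
move: (q ^+ (h * v)) (q ^+ h) (q ^+ v) (wt A) (wt (A + h.+1%:Z)) (wt (A + (h.+1 + v.+1)%N%:Z)).
move: (qfact h) (qfact v) (qfact (h.+1 + v)) P.
move=> f g hf P qhv qh qv w1 w2 w3 c1 c2 c3 n1 n2 n3 n4 n5 n6 n7 n8 B.
(* The last factor isolates the right side of [wt_balance], ready to be replaced by its left
   side. *)
transitivity (hf * P / (f * g * qhv * q * qh * qv * c1 * c2) * (c3 * w2)).
  by field; rewrite n1 n2 n3 n5 n6 n7 n8 q_neq0.
by rewrite -B; field; rewrite n1 n2 n3 n5 n6 n7 n8 q_neq0.
Qed.

Variables (x : nat).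

(* Paths from the segment between the triangles [2k] and [2k+1] of row [r] to
   the right side of row [c]. *)
Definition path_gf (r k c : nat) : F :=
  if (c <= r)%N && (k < x + c)%N
  then path_weight (x + c - k.+1) (r - c) (k.*2.+2%:Z - (x + r)%N%:Z) else 0.

Lemma path_gf_step r k c : (0 < r)%N -> (0 < c)%N -> (k.+1 < x + r)%N ->
  path_gf r k c = path_gf r k.+1 c + wt (k.*2.+2%:Z - (x + r)%N%:Z) * path_gf r.-1 k c.
Proof.
case: r => // r _ c_gt0 k_lt /=; rewrite /path_gf.
case: (ltngtP c r.+1) => [cr|cr|cr] /=; last first.
- rewrite cr subnn !path_weight0 ltnn /=.
  by rewrite mulr0 addr0 !ifT //; lia.
- by rewrite !ifF ?mulr0 ?addr0 //; lia.
have {}cr : (c <= r)%N by [].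
rewrite cr /=; case: (ltngtP k.+1 (x + c)) => kc.
- rewrite (subSn cr) (_ : x + c - k.+1 = (x + c - k.+2).+1)%N; last by lia.
  rewrite path_weightS; congr (path_weight _ _ _ + _ * path_weight _ _ _); lia.
- by rewrite mulr0 addr0.
- rewrite kc subnn (subSn cr) path_weight_vertical add0r.
  by congr (_ * path_weight _ _ _); lia.
Qed.

(** The last column of row [r] lies beyond the last column of every higher row, so a path there can
    only stop. *)
Lemma path_gf_sink r c : (0 < r)%N -> (0 < c)%N ->
  path_gf r (x + r).-1 c = (r == c)%:R.
Proof.
move=> r_gt0 c_gt0; rewrite /path_gf; case: (eqVneq r c) => [<-|rc].
  by rewrite subnn path_weight0 ifT //; lia.
by rewrite ifF //; lia.
Qed.

(** The parts of the generating function that depend on [x], one per end of a path. They are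
    mutually inverse as functions of the row, which later trades the sinks for the right dents. *)
Definition source_factor (a : nat) : F := qfact (x + a.-1) / q ^+ (x * a).
Definition sink_factor (c : nat) : F := q ^+ (x * c) / qfact (x + c.-1).
End PathWeights.

Definition path_core (F : fieldType) (X Y q : F) (a c : nat) : F :=
  if (c <= a)%N then
    (\prod_(l < a - c) wt X Y q (c.+1%:Z - a%:Z + l%:Z))
      / qfact q (a - c) / q ^+ (c.-1 * (a - c))
  else 0.

(** From column 0 the [x] in the starting axis cancels against the [x] in the number of horizontal
    steps, so the weights [wt] are free of [x]. The binomial and the power of [q] split into a part
    for [a], a part for [c] and a part in [a - c]. *)
Lemma path_gf_source (F : fieldType) (X Y q : F) x a c :
  q != 0 -> (forall k, (0 < k)%N -> q ^+ k != 1) -> (0 < a)%N -> (0 < c)%N ->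
  path_gf X Y q x a 0 c =
  source_factor q x a * path_core X Y q a c * sink_factor q x c.
Proof.
move=> q0 qfree a0 c0; rewrite /path_gf /path_core.
rewrite (_ : 0 < x + c)%N ?andbT; last by lia.
case: ifP => [ca|_]; last by rewrite mulr0 mul0r.
rewrite /path_weight /source_factor /sink_factor.
rewrite (_ : x + c - 1 = x + c.-1)%N; last by lia.
rewrite (_ : x + c.-1 + (a - c) = x + a.-1)%N; last by lia.
have -> : \prod_(l < a - c) wt X Y q (2 - (x + a)%N%:Z + (x + c.-1 + l)%N%:Z)
   = \prod_(l < a - c) wt X Y q (c.+1%:Z - a%:Z + l%:Z).
  by apply: eq_bigr => l _; congr wt; lia.
rewrite (_ : x * a = x * c + x * (a - c))%N; last by rewrite -mulnDr subnKC.
rewrite mulnDl !exprD; field; rewrite !expf_neq0 // !qfact_neq0 //.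
Qed.

(** * The determinant formula *)

Section Triangles.
Variables (x N : nat).
Implicit Types s t : tri x N.

Lemma tri_eqE s t : (s == t) = (trow s == trow t) && (tpos s == tpos t).
Proof. by case: s t => [? ?] [? ?]; rewrite xpair_eqE. Qed.

Lemma trow_gt0 t : (0 < trow t)%N. Proof. by []. Qed.

Lemma trow_le t : (trow t <= N)%N. Proof. exact: ltn_ord. Qed.

Lemma tri_exists r p : (0 < r <= N)%N -> (p <= (x + r).-1.*2)%N ->
  exists t : tri x N, trow t = r /\ tpos t = p.
Proof.
move=> rN pr; have r_lt : (r.-1 < N)%N by lia.
have p_lt : (p < (x + N).*2)%N by lia.
by exists (Ordinal r_lt, Ordinal p_lt); rewrite /trow /tpos /=; lia.
Qed.

Lemma adjacent_up s t : ~~ odd (tpos t) ->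
  adjacent t s = [|| (trow s == trow t) && (tpos s == (tpos t).+1),
                     (trow s == trow t) && ((tpos s).+1 == tpos t) |
                     (trow s == (trow t).+1) && (tpos s == (tpos t).+1)].
Proof.
have := trow_gt0 s; have := trow_gt0 t.
rewrite /adjacent /vertical /slanted /is_up /axis; lia.
Qed.

Lemma adjacent_down s t : odd (tpos t) ->
  adjacent t s = [|| (trow s == trow t) && (tpos s == (tpos t).+1),
                     (trow s == trow t) && ((tpos s).+1 == tpos t) |
                     ((trow s).+1 == trow t) && ((tpos s).+1 == tpos t)].
Proof.
have := trow_gt0 s; have := trow_gt0 t.
rewrite /adjacent /vertical /slanted /is_up /axis; lia.
Qed.
End Triangles.

(** Both families are the sorted list of one set, by counting. This identifies path positions with
    sinks in the final state. *)
Lemma increasing_codom_eq m (f g : 'I_m -> nat) :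
  (forall i j : 'I_m, (i < j)%N -> (f i < f j)%N) ->
  (forall i j : 'I_m, (i < j)%N -> (g i < g j)%N) ->
  (forall i, f i \in codom g) -> f =1 g.
Proof.
have srt (h : 'I_m -> nat) : (forall i j : 'I_m, (i < j)%N -> (h i < h j)%N) ->
    sorted ltn (codom h).
  move=> incr; rewrite codomE sorted_map.
  apply: (sub_sorted (e := relpre val ltn)) => [i j|]; first exact: incr.
  by rewrite -sorted_map val_enum_ord iota_ltn_sorted.
move=> /srt f_srt /srt g_srt fg.
have uniq_f := sorted_uniq ltn_trans ltnn f_srt.
have sub : {subset codom f <= codom g} by move=> _ /codomP[i ->].
have /(uniq_min_size uniq_f sub)[_ fg_eq] : (size (codom g) <= size (codom f))%N.
  by rewrite !size_codom.
have := irr_sorted_eq ltn_trans ltnn f_srt g_srt fg_eq; rewrite !codomE => E i.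
by apply: ((eq_in_map f g (enum 'I_m)).2 E); rewrite mem_enum.
Qed.

Lemma det_row0 (F : comNzRingType) m (A : 'M[F]_m) i :
  (forall j, A i j = 0) -> \det A = 0.
Proof. by move=> A0; rewrite (expand_det_row _ i) big1 // => j _; rewrite A0 mul0r. Qed.

Lemma det_col0 (F : comNzRingType) m (A : 'M[F]_m) j :
  (forall i, A i j = 0) -> \det A = 0.
Proof. by move=> A0; rewrite (expand_det_col _ j) big1 // => i _; rewrite A0 mul0r. Qed.

(** * Sweeping the vertices of the path graph level by level *)

Section NonintersectingPaths.
Variables (F : fieldType) (X Y q : F).
Hypothesis q_neq0 : q != 0.
Hypothesis q_free : forall k, (0 < k)%N -> q ^+ k != 1.
Variables (x N m : nat) (B : pred nat) (c : 'I_m -> nat).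
Hypothesis c_incr : forall i j : 'I_m, (i < j)%N -> (c i < c j)%N.
Hypothesis c_range : forall j, (0 < c j <= N)%N.
Hypothesis c_notB : forall j, ~~ B (c j).
Hypothesis notB_c : forall r, (0 < r <= N)%N -> ~~ B r -> r \in codom c.

Implicit Types (rr kk : 'I_m -> nat) (t s : tri x N).

(* The vertex (r, k) of the path graph is the segment between the up-pointing
   triangle [2k] and the down-pointing triangle [2k+1] of row [r]; its level is
   [k + N - r].  Vertices are removed by increasing level and, within a level,
   from top to bottom; (L, rho) are the level and row of the next one. *)
Definition pending (L rho r k : nat) : bool :=
  (L < k + N - r)%N || ((k + N - r == L) && (rho <= r))%N.

(* The i-th path has been followed up to the vertex (rr i, kk i), whose
   up-pointing triangle is already covered; [B] is the set of rows with a right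
   dent. *)
Definition remaining (L rho : nat) rr kk : {set tri x N} :=
  [set t | [&& (tpos t <= last_tpos t)%N,
               ~~ (B (trow t) && (tpos t == last_tpos t)),
               pending L rho (trow t) (tpos t)./2
             & [forall i, ~~ ((trow t == rr i) && (tpos t == (kk i).*2))]]].

Lemma remainingP L rho rr kk t :
  reflect [/\ (tpos t <= (x + trow t).-1.*2)%N,
              ~~ (B (trow t) && (tpos t == (x + trow t).-1.*2)),
              pending L rho (trow t) (tpos t)./2
            & forall i, ~~ ((trow t == rr i) && (tpos t == (kk i).*2))]
          (t \in remaining L rho rr kk).
Proof.
rewrite inE /last_tpos; apply: (iffP and4P) => -[h1 h2 h3 h4]; split=> //.
  exact/forallP.
exact/forallP.
Qed.

Definition gf_matrix rr kk : 'M[F]_m :=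
  \matrix_(i, j) path_gf X Y q x (rr i) (kk i) (c j).

(** Increasing rows express that the paths do not cross. By the last clause a path either still
    waits in column 0 or is at most one level ahead of the sweep, because each step raises the level
    by one. *)
Definition admissible (L rho : nat) rr kk : Prop :=
  [/\ forall i, (0 < rr i <= N)%N /\ (kk i < x + rr i)%N,
      forall i j : 'I_m, (i < j)%N -> (rr i < rr j)%N,
      forall i, pending L rho (rr i) (kk i)
    & forall i, kk i = 0%N \/ (kk i + N - rr i <= L.+1)%N].

Definition upd (f : 'I_m -> nat) (i0 : 'I_m) (v : nat) : 'I_m -> nat :=
  fun i => if i == i0 then v else f i.

(** On the last level only rightmost up-pointing triangles can remain, and no two are adjacent. If
    the paths occupy all sinks, the region is empty and the matrix is the identity; otherwise an
    isolated triangle kills the left side and a zero column kills the right side. *)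
Lemma remaining_final rr kk : admissible (x + N).-1 0 rr kk ->
  M X Y q (remaining (x + N).-1 0 rr kk) = \det (gf_matrix rr kk).
Proof.
case=> range incr pend _.
have kkE i : kk i = (x + rr i).-1.
  by have := range i; have := pend i; rewrite /pending; lia.
have gfE i j : gf_matrix rr kk i j = (rr i == c j)%:R.
  have [ri _] := range i; have cj := c_range j; rewrite mxE kkE path_gf_sink //; lia.
have posE t : t \in remaining (x + N).-1 0 rr kk -> tpos t = (x + trow t).-1.*2.
  have := trow_gt0 t; have := trow_le t.
  by move=> ? ? /remainingP[]; rewrite /pending; lia.
case: (boolP [forall j, c j \in codom rr]) => [/forallP all_c|].
  have crr := increasing_codom_eq c_incr incr all_c.
  have -> : remaining (x + N).-1 0 rr kk = set0.
    apply/setP => t; rewrite [RHS]inE; apply/negP => tR; have tE := posE t tR.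
    case/remainingP: tR => _; rewrite tE eqxx andbT => notBt _.
    have /codomP[j cj] : trow t \in codom c.
      by apply: notB_c => //; rewrite trow_gt0 trow_le.
    by move=> /(_ j); rewrite -crr -cj eqxx kkE -crr -cj eqxx.
  rewrite M_set0 (_ : gf_matrix rr kk = 1%:M) ?det1 //.
  apply/matrixP => i j; rewrite gfE -crr mxE; congr (_%:R); congr nat_of_bool.
  apply/eqP/eqP => [E|-> //]; apply/val_inj => /=.
  by case: (ltngtP i j) => // /c_incr; rewrite E ltnn.
rewrite negb_forall => /existsP[j cj].
rewrite (det_col0 (j := j)) => [|i]; last first.
  by rewrite gfE; case: eqP => // E; case/negP: cj; rewrite -E codom_f.
have /(tri_exists (c_range j))[t [tr tp]] : ((x + c j).-1.*2 <= (x + c j).-1.*2)%N by [].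
have tR : t \in remaining (x + N).-1 0 rr kk.
  apply/remainingP; rewrite tr tp leqnn (negPf (c_notB j)); split=> //.
    by have := c_range j; rewrite /pending; lia.
  move=> i; apply/negP => /andP[/eqP E _].
  by case/negP: cj; rewrite E codom_f.
rewrite (M_peel_adjacent _ _ _ tR) big_pred0 // => s; apply/negP => /andP[ts /posE sp].
move: ts; rewrite adjacent_up; last by rewrite tp odd_double.
by rewrite sp tp; lia.
Qed.

Lemma pending_next L rho r k : pending L rho r k ->
  ~~ ((k + N - r == L) && (r == rho))%N -> pending L rho.+1 r k.
Proof. rewrite /pending; lia. Qed.

Lemma pendingW L rho r k : pending L rho.+1 r k -> pending L rho r k.
Proof. rewrite /pending; lia. Qed.

(** * Removal of a single vertex *)

Section Step.
Variables (L rho : nat) (rr kk : 'I_m -> nat).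
Hypothesis adm : admissible L rho rr kk.
Hypothesis rhoP : (0 < rho <= N)%N.
Hypothesis L_ge : (N <= L + rho)%N.
Hypothesis L_lt : (L.+1 < x + N)%N.
Let k := (L + rho - N)%N.

Lemma step_col_level : (k + N - rho = L)%N. Proof. rewrite /k; lia. Qed.

Lemma step_col_lt : (k.+1 < x + rho)%N. Proof. rewrite /k; lia. Qed.

(** The left and lower neighbours of the up-pointing triangle [2k] belong to vertices of level
    [L - 1], already removed, so it must be paired with [2k+1]. *)
Lemma M_remaining_forced : (forall i, ~~ ((rr i == rho) && (kk i == k))) ->
  M X Y q (remaining L rho rr kk) = M X Y q (remaining L rho.+1 rr kk).
Proof.
move=> noz; have kL := step_col_level; have kx := step_col_lt.
have [|u [ur up]] := @tri_exists x N rho k.*2 rhoP; first by lia.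
have [|d [dr dp]] := @tri_exists x N rho k.*2.+1 rhoP; first by lia.
have uR : u \in remaining L rho rr kk.
  apply/remainingP; rewrite ur up; split; try by rewrite /pending; lia.
  by move=> i; have := noz i; lia.
have dR : d \in remaining L rho rr kk.
  by apply/remainingP; rewrite dr dp; split; rewrite /pending; lia.
rewrite (M_peel_adjacent _ _ _ uR) (big_pred1 d) => [|s]; last first.
  rewrite /= adjacent_up ?up ?odd_double // tri_eqE dr dp ur; apply/idP/idP.
    case/andP => h /remainingP[]; have := trow_le s; rewrite /pending; lia.
  move=> h; rewrite (_ : s = d) ?dR ?dr ?dp ?eqxx //.
  by apply/eqP; rewrite tri_eqE dr dp.
rewrite lozenge_weight_slanted ?mul1r; last first.
  by rewrite /slanted ur dr up dp !eqxx.
congr M; apply/setP => t; rewrite in_setD in_set2 !tri_eqE ur up dr dp.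
have tN := trow_le t.
apply/andP/remainingP => [[t_ud /remainingP[h1 h2 h3 h4]]|[h1 h2 h3 h4]].
  by split=> //; apply: pending_next => //; lia.
split; first by move: h3; rewrite /pending; lia.
by apply/remainingP; split=> //; apply: pendingW.
Qed.

Variable i0 : 'I_m.
Hypothesis i0_row : rr i0 = rho.
Hypothesis i0_col : kk i0 = k.

Lemma rr_inj i : rr i = rho -> i = i0.
Proof.
case: adm => _ incr _ _ E; apply/val_inj => /=.
by case: (ltngtP i i0) => // /incr; rewrite E i0_row ltnn.
Qed.

Lemma remaining_move (d s : tri x N) r' k' :
  trow d = rho -> tpos d = k.*2.+1 -> trow s = r' -> tpos s = k'.*2 ->
  remaining L rho rr kk :\: [set d; s] =
  remaining L rho.+1 (upd rr i0 r') (upd kk i0 k').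
Proof.
move=> dr dp sr sp; have kL := step_col_level.
apply/setP => t; rewrite in_setD in_set2 !tri_eqE dr dp sr sp.
have tN := trow_le t.
apply/andP/remainingP => [[t_ds /remainingP[h1 h2 h3 h4]]|[h1 h2 h3 h4]].
  split=> //.
    by apply: pending_next => //; have := h4 i0; rewrite i0_row i0_col; lia.
  by move=> i; rewrite /upd; case: (i =P i0) => _; [lia | exact: h4].
split; first by have := h4 i0; rewrite /upd eqxx; move: h3; rewrite /pending; lia.
apply/remainingP; split=> //; first exact: pendingW.
move=> i; case: (eqVneq i i0) => [->|ne].
  by rewrite i0_row i0_col; move: h3; rewrite /pending; lia.
by have := h4 i; rewrite /upd (negPf ne).
Qed.

Lemma admissible_right : admissible L rho.+1 (upd rr i0 rho) (upd kk i0 k.+1).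
Proof.
have kL := step_col_level; have kx := step_col_lt; case: adm => range incr pend near.
have rrE i : upd rr i0 rho i = rr i by rewrite /upd; case: eqP => [->|].
split=> [i|i j|i|i]; rewrite ?rrE.
- have [? ?] := range i; split=> //; rewrite /upd; case: eqP => [->|//].
  by rewrite i0_row.
- exact: incr.
- rewrite /upd; case: (eqVneq i i0) => [->|ne]; first by rewrite /pending i0_row; lia.
  apply: pending_next => //; apply: contra ne => /andP[_ /eqP E].
  by apply/eqP/rr_inj.
- by rewrite /upd; case: eqP => [->|_]; [rewrite i0_row; lia | have := near i; lia].
Qed.

(* A path standing in the row above can only stand at the end point of the
   vertical step of path [i0], so non-crossing reduces to non-collision. *)
Lemma blocking_col i : (rr i).+1 = rho -> kk i = k.
Proof.
have kL := step_col_level; case: adm => range incr pend near E.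
by have := pend i; have := near i; have := range i; rewrite /pending; lia.
Qed.

Lemma admissible_up : (1 < rho)%N -> (forall i, (rr i).+1 != rho) ->
  admissible L rho.+1 (upd rr i0 rho.-1) (upd kk i0 k).
Proof.
move=> rho1 free.
have kL := step_col_level; have kx := step_col_lt; case: adm => range incr pend near.
have kkE i : upd kk i0 k i = kk i by rewrite /upd; case: eqP => [->|].
split=> [i|i j|i|i]; rewrite ?kkE.
- by rewrite /upd; case: eqP => [->|_]; [rewrite i0_col; lia | exact: range].
- rewrite /upd; case: (eqVneq i i0) => [->|ne]; case: (eqVneq j i0) => [->|ne'] ij.
  + by rewrite ltnn in ij.
  + by have := incr _ _ ij; rewrite i0_row; lia.
  + by have := incr _ _ ij; have := free i; rewrite i0_row; lia.
  + exact: incr.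
- rewrite /upd; case: (eqVneq i i0) => [->|ne].
    by rewrite /pending i0_col; lia.
  apply: pending_next => //; apply: contra ne => /andP[_ /eqP E].
  by apply/eqP/rr_inj.
- by rewrite /upd; case: eqP => [->|_]; [rewrite i0_col; lia | have := near i; lia].
Qed.

(** [path_gf_step] writes row [i0] as a linear combination of two rows, and the determinant is
    linear in that row. *)
Lemma det_gf_matrix_step :
  \det (gf_matrix rr kk) =
  \det (gf_matrix (upd rr i0 rho) (upd kk i0 k.+1)) +
  wt X Y q (k.*2.+2%:Z - (x + rho)%N%:Z) *
    \det (gf_matrix (upd rr i0 rho.-1) (upd kk i0 k)).
Proof.
have kx := step_col_lt.
rewrite -[X in X + _]mul1r; apply: (determinant_multilinear (i0 := i0)).
- apply/rowP => j; rewrite !mxE /upd eqxx i0_row i0_col mul1r.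
  by apply: path_gf_step => //; [lia | have := c_range j; lia].
- by apply/matrixP => i j; rewrite !mxE /upd eq_sym (negPf (neq_lift _ _)).
- by apply/matrixP => i j; rewrite !mxE /upd eq_sym (negPf (neq_lift _ _)).
Qed.

(** A path that ends at a right dent has reached no sink, so its row of the matrix vanishes. *)
Lemma det_gf_matrix_dent rr' kk' i : (0 < rr' i)%N -> B (rr' i) ->
  kk' i = (x + rr' i).-1 -> \det (gf_matrix rr' kk') = 0.
Proof.
move=> r0 Bi kE; apply: (det_row0 (i := i)) => j.
rewrite mxE kE path_gf_sink //; last by have := c_range j; lia.
by case: eqP Bi => // ->; rewrite (negPf (c_notB j)).
Qed.

Lemma M_remaining_particle :
  (forall rr' kk', admissible L rho.+1 rr' kk' ->
     M X Y q (remaining L rho.+1 rr' kk') = \det (gf_matrix rr' kk')) ->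
  M X Y q (remaining L rho rr kk) = \det (gf_matrix rr kk).
Proof.
move=> IH; have kL := step_col_level; have kx := step_col_lt.
have [|d [dr dp]] := @tri_exists x N rho k.*2.+1 rhoP; first by lia.
have dR : d \in remaining L rho rr kk.
  by apply/remainingP; rewrite dr dp; split; rewrite /pending; lia.
rewrite (M_peel_adjacent _ _ _ dR) (bigID (fun s => trow s == rho)) /=.
rewrite det_gf_matrix_step; congr (_ + _).
  have [|s [sr sp]] := @tri_exists x N rho k.+1.*2 rhoP; first by lia.
  case: (boolP (s \in remaining L rho rr kk)) => sR.
    rewrite (big_pred1 s) => [|t]; last first.
      rewrite /= adjacent_down ?dp /= ?odd_double // tri_eqE dr sr sp.
      apply/idP/idP => [/andP[/andP[h /remainingP[_ _ _ /(_ i0)]]]|h].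
        by rewrite i0_row i0_col; lia.
      have -> : t = s by apply/eqP; rewrite tri_eqE sr sp.
      by rewrite sR sr sp doubleS !eqxx.
    rewrite lozenge_weight_slanted; last by rewrite /slanted dr dp sr sp doubleS !eqxx.
    by rewrite mul1r (remaining_move dr dp sr sp) IH //; apply: admissible_right.
  (* The right neighbour can be missing only as a right dent. *)
  rewrite big_pred0 => [|t]; last first.
    apply/negP; rewrite adjacent_down ?dp /= ?odd_double //.
    move=> /andP[/andP[h tR] tr]; case/remainingP: (tR) => _ _ _ /(_ i0).
    rewrite i0_row i0_col => h2.
    have E : t = s by apply/eqP; rewrite tri_eqE sr sp; lia.
    by rewrite -E tR in sR.
  symmetry; apply: (@det_gf_matrix_dent _ _ i0); rewrite /upd eqxx; first by lia.
    apply: contraNT sR => notB; apply/remainingP; rewrite sr sp (negPf notB).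
    split=> //; try by rewrite /pending; lia.
    move=> i; apply/negP => /andP[/eqP E]; have := rr_inj (esym E) => ->.
    by rewrite i0_col; lia.
  have : s \notin remaining L rho rr kk by [].
  have [//|ne] := eqVneq k.+1 (x + rho).-1.
  case/negP; apply/remainingP; rewrite sr sp.
  split=> //; try by rewrite /pending; lia.
  move=> i; apply/negP => /andP[/eqP E]; have := rr_inj (esym E) => ->.
  by rewrite i0_col; lia.
case: (pickP (fun s => [&& (trow s).+1 == rho, tpos s == k.*2 & s \in remaining L rho rr kk])).
  move=> s /and3P[/eqP sr /eqP sp sR].
  rewrite (big_pred1 s) => [|t]; last first.
    rewrite /= adjacent_down ?dp /= ?odd_double // tri_eqE dr sp.
    apply/idP/idP => [/andP[/andP[h _]]|h]; first by lia.
    have -> : t = s by apply/eqP; rewrite tri_eqE sp.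
    by rewrite sR sp sr !eqxx /=; lia.
  have sr' : trow s = rho.-1 by rewrite -sr.
  rewrite setUC lozenge_weight_vertical; last first.
    by rewrite /vertical /is_up /axis dr dp sp sr'; lia.
  rewrite setUC (remaining_move dr dp sr' sp) IH.
    by rewrite /wt (_ : axis s = k.*2.+2%:Z - (x + rho)%N%:Z) // /axis sp; lia.
  apply: admissible_up; first by have := trow_gt0 s; lia.
  move=> i; apply/negP => /eqP E; case/remainingP: sR => _ _ _ /(_ i).
  by rewrite (blocking_col E) sp; lia.
(* The upper neighbour is missing for one of three reasons: row 1 has no row above, another path
   occupies it, or it is a right dent. The determinant then has a zero row, two equal rows, or a
   zero row. *)
move=> none; rewrite big_pred0 => [|t]; last first.
  apply/negP; rewrite adjacent_down ?dp /= ?odd_double // dr => /andP[/andP[h tR] h'].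
  by have := none t; rewrite tR; lia.
have [rho1|rho1] := leqP rho 1.
  rewrite (det_row0 (i := i0)) ?mulr0 // => j.
  by rewrite mxE /upd eqxx /path_gf ifF //; have := c_range j; lia.
case: (pickP (fun i => (rr i).+1 == rho)) => [i /eqP E|free].
  rewrite (determinant_alternate (i1 := i) (i2 := i0)) ?mulr0 //.
    by apply/eqP => E'; move: E; rewrite E' i0_row; lia.
  move=> j; rewrite !mxE /upd eqxx; case: eqP => // _.
  by rewrite (blocking_col E) -E.
have [||s [sr sp]] := @tri_exists x N rho.-1 k.*2; [lia | lia |].
have := none s; rewrite sr sp prednK ?eqxx /=; last by lia.
move=> /negbT sR; rewrite (@det_gf_matrix_dent _ _ i0) ?mulr0 //; rewrite /upd eqxx.
- by lia.
- apply: contraNT sR => notB; apply/remainingP; rewrite sr sp (negPf notB).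
  split=> //; try by rewrite /pending; lia.
  by move=> i; have := free i; lia.
have [//|ne] := eqVneq k (x + rho.-1).-1.
case/negP: sR; apply/remainingP; rewrite sr sp.
split=> //; try by rewrite /pending; lia.
by move=> i; have := free i; lia.
Qed.
End Step.

Theorem M_remaining L rr kk : (L <= (x + N).-1)%N -> admissible L 0 rr kk ->
  M X Y q (remaining L 0 rr kk) = \det (gf_matrix rr kk).
Proof.
move Ed : ((x + N).-1 - L)%N => d.
elim: d L Ed rr kk => [|d IHd] L Ed rr kk L_lt adm.
  have LE : L = (x + N).-1 by lia.
  by rewrite LE in adm *; apply: remaining_final.
(* Within a level the induction is on [rho], the number of rows from the current one down to row
   [N]. *)
suff step rho rr' kk' : (rho <= N.+1)%N -> admissible L (N.+1 - rho) rr' kk' ->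
    M X Y q (remaining L (N.+1 - rho) rr' kk') = \det (gf_matrix rr' kk').
  by have := step N.+1 rr kk; rewrite subnn; apply.
elim: rho rr' kk' => [|rho IHrho] rr' kk' rhoN adm'.
  rewrite subn0 in adm' *.
  (* Past row [N] the level is exhausted, which is the same state as the start of the next level. *)
  have pendE r k : (r <= N)%N -> pending L N.+1 r k = pending L.+1 0 r k.
    by rewrite /pending; lia.
  have -> : remaining L N.+1 rr' kk' = remaining L.+1 0 rr' kk'.
    by apply/setP => t; rewrite !inE pendE // trow_le.
  apply: IHd; [lia | lia |]; case: adm' => range incr pend near; split=> // i.
    by rewrite -pendE //; have := range i; lia.
  by have := near i; lia.
have {}IHrho rr1 kk1 := IHrho rr1 kk1 (ltnW rhoN).
have E : (N.+1 - rho = (N.+1 - rho.+1).+1)%N by lia.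
rewrite {}E in IHrho; move: (N.+1 - rho.+1)%N IHrho adm' => rho' IH adm'.
have [/andP[rhoP L_ge]|novertex] := boolP ((0 < rho' <= N) && (N <= L + rho'))%N.
  case: (pickP (fun i => (rr' i == rho') && (kk' i == L + rho' - N)%N)).
    move=> i0 /andP[/eqP i0_row /eqP i0_col].
    by apply: (M_remaining_particle adm' rhoP L_ge _ i0_row i0_col); [lia | exact: IH].
  move=> noz; rewrite M_remaining_forced //; [|lia|by move=> i; rewrite noz].
  apply: IH.
  case: adm' => range incr pend near; split=> // i.
  by apply: pending_next => //; have := noz i; have := range i; lia.
(* Level [L] has no vertex in this row (it would have row 0 or a negative column), so nothing is
   removed. *)
have pendE r k : (0 < r <= N)%N -> pending L rho'.+1 r k = pending L rho' r k.
  by move: novertex; rewrite /pending; lia.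
have -> : remaining L rho' rr' kk' = remaining L rho'.+1 rr' kk'.
  by apply/setP => t; rewrite !inE pendE // trow_gt0 trow_le.
apply: IH.
case: adm' => range incr pend near; split=> // i.
by rewrite pendE //; have := range i; lia.
Qed.
End NonintersectingPaths.

(** * Dependence on the top side *)

Lemma codom_complement m n (b : 'I_n -> nat) :
  (forall j, (1 <= b j <= m + n)%N) ->
  (forall j j' : 'I_n, (j < j')%N -> (b j < b j')%N) ->
  exists c : 'I_m -> nat,
    (forall i j : 'I_m, (i < j)%N -> (c i < c j)%N) /\
    perm_eq (codom c ++ codom b) (iota 1 (m + n)).
Proof.
move=> b_range b_incr.
have uniq_b : uniq (codom b).
  apply/injectiveP => i j E; apply/val_inj => /=.
  by case: (ltngtP i j) => // /b_incr; rewrite E ltnn.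
pose cs := [seq r <- iota 1 (m + n) | r \notin codom b].
have perm_cs : perm_eq (cs ++ codom b) (iota 1 (m + n)).
  apply: uniq_perm; rewrite ?iota_uniq // ?cat_uniq ?uniq_b ?filter_uniq ?iota_uniq //=.
    by rewrite andbT -all_predC; apply/allP => r rb /=; rewrite mem_filter rb.
  move=> r; rewrite mem_cat mem_filter.
  case: (boolP (r \in codom b)) => [rb|] /=; last by rewrite orbF.
  by symmetry; case/codomP: rb => j ->; have := b_range j; rewrite mem_iota; lia.
have size_cs : size cs = m.
  have := perm_size perm_cs; rewrite size_cat size_codom card_ord size_iota; lia.
have sorted_cs : sorted ltn cs.
  by apply: sorted_filter; [exact: ltn_trans | exact: iota_ltn_sorted].
exists (fun j => nth 0%N cs j); split=> [i j ij|].
  by apply: (sorted_ltn_nth ltn_trans) => //; rewrite inE size_cs.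
suff -> : codom (fun j : 'I_m => nth 0%N cs j) = cs by [].
rewrite codomE (map_comp (nth 0%N cs) val) val_enum_ord -size_cs.
exact: mkseq_nth.
Qed.

Lemma big_complement (R : Type) (idx : R) (op : Monoid.com_law idx) m n
    (c : 'I_m -> nat) (b : 'I_n -> nat) (f : nat -> R) :
  perm_eq (codom c ++ codom b) (iota 1 (m + n)) ->
  op (\big[op/idx]_(i < m) f (c i)) (\big[op/idx]_(j < n) f (b j)) =
  \big[op/idx]_(r < m + n) f r.+1.
Proof.
move=> cb; transitivity (\big[op/idx]_(r <- codom c ++ codom b) f r).
  by rewrite big_cat /= !big_image.
rewrite (perm_big _ cb) (iotaDl 1 0) big_map -(big_mkord xpredT (fun r => f r.+1)).
by rewrite /index_iota subn0; apply: eq_bigr.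
Qed.

(** * The factor depending on the top side, and its ratio *)

Section Ratio.
Variables (F : fieldType) (X Y q : F).
Hypothesis q_neq0 : q != 0.
Hypothesis q_free : forall k, (0 < k)%N -> q ^+ k != 1.

Lemma source_factor_neq0 x a : source_factor q x a != 0.
Proof. by rewrite mulf_neq0 ?invr_eq0 ?expf_neq0 ?qfact_neq0. Qed.

(** The sinks contribute inverse source factors over the complement of [b], that is, the product
    over [b] divided by the product over all rows. Hence the symmetry in [a] and [b]. *)
Definition dent_factor (x m n : nat) (a : 'I_m -> nat) (b : 'I_n -> nat) : F :=
  (\prod_(i < m) source_factor q x (a i)) * (\prod_(j < n) source_factor q x (b j))
  / \prod_(r < m + n) source_factor q x r.+1.

Lemma M_region_factor m n (a : 'I_m -> nat) (b : 'I_n -> nat) :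
  (forall i, (1 <= a i <= m + n)%N) -> (forall j, (1 <= b j <= m + n)%N) ->
  (forall i i' : 'I_m, (i < i')%N -> (a i < a i')%N) ->
  (forall j j' : 'I_n, (j < j')%N -> (b j < b j')%N) ->
  exists D : F, forall x, M X Y q (region x a b) = dent_factor x a b * D.
Proof.
move=> a_range b_range a_incr b_incr.
have [c [c_incr cb]] := codom_complement b_range b_incr.
have memN r : (r \in codom c) || (r \in codom b) = (0 < r <= m + n)%N.
  by rewrite -mem_cat (perm_mem cb) mem_iota; lia.
have c_range j : (0 < c j <= m + n)%N by rewrite -memN codom_f.
have c_notB j : c j \notin codom b.
  have := perm_uniq cb; rewrite iota_uniq cat_uniq => /and3P[_ /hasPn disj _].
  by apply/negP => /disj; rewrite codom_f.
have notB_c r : (0 < r <= m + n)%N -> r \notin codom b -> r \in codom c.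
  by rewrite -memN => /orP[|->].
(* This determinant is chosen before [x], so one constant serves every top side. *)
exists (\det (\matrix_(i < m, j < m) path_core X Y q (a i) (c j))) => x.
have -> : region x a b =
    @remaining x (m + n) m (fun r => r \in codom b) 0 0 a (fun=> 0%N).
  apply/setP => t; rewrite !inE /pending /= andbA; case: (tpos t <= _)%N => //=.
  rewrite andbC; congr (_ && _).
  rewrite (_ : (_ || _) = true) /=; last by lia.
  apply/idP/forallP => [|h].
    rewrite negb_and => /orP[/negP h|/negPf h] i; last by rewrite h andbF.
    by apply/negP => /andP[/eqP E _]; apply: h; rewrite E codom_f.
  by apply/negP => /andP[/codomP[i E] tp]; have := h i; rewrite E eqxx tp.
rewrite (M_remaining X Y q_neq0 q_free c_incr c_range c_notB notB_c) //; last first.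
  split=> [i|//|i|i]; [by have := a_range i; lia | | by left].
  by rewrite /pending; lia.
pose dS := \row_i source_factor q x (a i); pose dT := \row_j sink_factor q x (c j).
have -> : gf_matrix X Y q x c a (fun=> 0%N) =
    diag_mx dS *m (\matrix_(i < m, j < m) path_core X Y q (a i) (c j)) *m diag_mx dT.
  apply/matrixP => i j; rewrite mul_mx_diag mul_diag_mx !mxE.
  by have := a_range i; have := c_range j => ? ?; apply: path_gf_source => //; lia.
rewrite !det_mulmx !det_diag mulrAC; congr (_ * _).
have prodS : \prod_(i < m) dS 0 i = \prod_(i < m) source_factor q x (a i).
  by apply: eq_bigr => i _; rewrite mxE.
have prodT : \prod_(j < m) dT 0 j = (\prod_(j < m) source_factor q x (c j))^-1.
  rewrite -prodfV; apply: eq_bigr => j _; rewrite mxE /source_factor /sink_factor.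
  by rewrite invfM invrK mulrC.
rewrite prodS prodT /dent_factor -(big_complement _ (source_factor q x) cb) /=.
rewrite -!mulrA; congr (_ * _); rewrite invfM mulrCA divff ?mulr1 //.
by apply/prodf_neq0 => *; apply: source_factor_neq0.
Qed.

(** The minus sign in the argument undoes the plus sign in [qpoch]. *)
Lemma qfact_qpoch x i k :
  qfact q (x + i + k) =
  qpoch (- q ^+ (2 * (x + i.+1))) (q ^+ 2) k * qfact q (x + i).
Proof.
elim: k => [|k IHk]; first by rewrite addn0 /qpoch big_nil mul1r.
rewrite addnS qfactS IHk /qpoch big_nat_recr //= mulrAC; congr (_ * _ * _).
by rewrite mulNr exprM -exprD addnS addSn.
Qed.

(** The new layer of the triple product telescopes in its last index. *)
Lemma PP_step x m n : PP (q ^+ 2) x.+1 m n =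
  PP (q ^+ 2) x m n *
  \prod_(i < m) ((1 - (q ^+ 2) ^+ (x + n + i).+1) / (1 - (q ^+ 2) ^+ (x + i).+1)).
Proof.
rewrite /PP big_nat_recr //=; congr (_ * _).
rewrite big_add1 /= big_mkord; apply: eq_bigr => i _.
elim: n => [|n IHn]; first by rewrite big_nil addn0 divff // qfact_factor_neq0.
rewrite big_nat_recr //= IHn.
rewrite (_ : x.+1 + i.+1 + n.+1 - 1 = (x + n.+1 + i).+1)%N; last by lia.
rewrite (_ : x.+1 + i.+1 + n.+1 - 2 = (x + n + i).+1)%N; last by lia.
rewrite -[_ - 1 in X in _ * (X / _)]opprB -[_ - 1 in X in _ * (_ / X)]opprB invrN mulrNN.
by rewrite mulrC mulrA divfK // qfact_factor_neq0.
Qed.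

Lemma PP_neq0 x m n : PP (q ^+ 2) x m n != 0.
Proof.
elim: x => [|x IHx]; first by rewrite /PP big_nil oner_neq0.
rewrite PP_step mulf_neq0 //; apply/prodf_neq0 => i _.
by rewrite mulf_neq0 ?invr_eq0 ?qfact_factor_neq0.
Qed.

Lemma prod_qfactS x m : \prod_(i < m) qfact q (x.+1 + i) =
  (\prod_(i < m) qfact q (x + i)) * \prod_(i < m) (1 - (q ^+ 2) ^+ (x + i).+1).
Proof. by rewrite -big_split; apply: eq_bigr => i _ /=; rewrite addSn qfactS. Qed.

Lemma PP_qfact m n : exists2 K, K != 0 & forall x,
  \prod_(r < m + n) qfact q (x + r) =
  K * PP (q ^+ 2) x m n *
    ((\prod_(i < m) qfact q (x + i)) * \prod_(j < n) qfact q (x + j)).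
Proof.
have prod_neq0 x k : \prod_(i < k) qfact q (x + i) != 0.
  by apply/prodf_neq0 => *; apply: qfact_neq0.
(* The constant is read off at [x = 0], where [PP] is an empty product; the induction on [x] then
   compares successive ratios. *)
pose H k := \prod_(i < k) qfact q (0 + i).
exists (H (m + n)%N / (H m * H n)); first by rewrite !mulf_neq0 ?invr_eq0 ?mulf_neq0 ?prod_neq0.
elim=> [|x IHx].
  by rewrite /PP big_nil mulr1 divfK // mulf_neq0 // prod_neq0.
rewrite !prod_qfactS {}IHx PP_step prodf_div addnC big_split_ord /=.
have -> : \prod_(i < m) (1 - (q ^+ 2) ^+ (x + (n + i)).+1) =
          \prod_(i < m) (1 - (q ^+ 2) ^+ (x + n + i).+1).
  by apply: eq_bigr => i _; rewrite addnA.
field; rewrite !prod_neq0 /= ?andbT; apply/prodf_neq0 => i _.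
exact: qfact_factor_neq0.
Qed.

Lemma prod_source_factor x m (a : 'I_m -> nat) :
  \prod_(i < m) source_factor q x (a i) =
  (\prod_(i < m) qfact q (x + (a i).-1)) / q ^+ (x * \sum_(i < m) a i).
Proof. by rewrite prodf_div big_distrr /= -expr_sum. Qed.

Lemma increasing_gt_index m (a : 'I_m -> nat) : (forall i, (0 < a i)%N) ->
  (forall i i' : 'I_m, (i < i')%N -> (a i < a i')%N) -> forall i : 'I_m, (i < a i)%N.
Proof.
move=> a_gt0 a_incr [i im]; elim: i im => [|i IHi] im //=.
exact: leq_ltn_trans (IHi (ltnW im)) (a_incr (Ordinal (ltnW im)) (Ordinal im) _).
Qed.

Lemma prod_qfact_qpoch x m (a : 'I_m -> nat) : (forall i : 'I_m, (i < a i)%N) ->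
  \prod_(i < m) qfact q (x + (a i).-1) =
  (\prod_(i < m) qpoch (- q ^+ (2 * (x + i.+1))) (q ^+ 2) (a i - i.+1)) *
  \prod_(i < m) qfact q (x + i).
Proof.
move=> a_gt; rewrite -big_split; apply: eq_bigr => i _ /=; rewrite -qfact_qpoch.
by congr qfact; have := a_gt i; lia.
Qed.

Lemma sum_triangular N : (\sum_(r < N) r.+1 = N * (N + 1) %/ 2)%N.
Proof.
elim: N => [|N IHN]; first by rewrite big_ord0.
rewrite big_ord_recr /= IHN (_ : N.+1 * (N.+1 + 1) = N.+1 * 2 + N * (N + 1))%N; last by ring.
by rewrite divnMDl // addnC.
Qed.

Lemma dent_factor_ratio x y m n (a : 'I_m -> nat) (b : 'I_n -> nat) :
  (forall i : 'I_m, (i < a i)%N) -> (forall j : 'I_n, (j < b j)%N) ->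
  dent_factor x a b / dent_factor y a b =
    q ^ ((y%:Z - x%:Z) *
         ((\sum_(i < m) a i)%N%:Z + (\sum_(j < n) b j)%N%:Z
          - ((m + n) * (m + n + 1) %/ 2)%N%:Z))
    * (PP (q ^+ 2) y m n / PP (q ^+ 2) x m n)
    * (\prod_(i < m)
         (qpoch (- q ^+ (2 * (x + i.+1))) (q ^+ 2) (a i - i.+1) /
          qpoch (- q ^+ (2 * (y + i.+1))) (q ^+ 2) (a i - i.+1)))
    * (\prod_(j < n)
         (qpoch (- q ^+ (2 * (x + j.+1))) (q ^+ 2) (b j - j.+1) /
          qpoch (- q ^+ (2 * (y + j.+1))) (q ^+ 2) (b j - j.+1))).
Proof.
move=> a_gt b_gt; have [K K_neq0 KP] := PP_qfact m n.
pose S := ((\sum_(i < m) a i)%N%:Z + (\sum_(j < n) b j)%N%:Z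
          - ((m + n) * (m + n + 1) %/ 2)%N%:Z).
pose A z := \prod_(i < m) qpoch (- q ^+ (2 * (z + i.+1))) (q ^+ 2) (a i - i.+1).
pose B z := \prod_(j < n) qpoch (- q ^+ (2 * (z + j.+1))) (q ^+ 2) (b j - j.+1).
have prod_neq0 z k : \prod_(i < k) qfact q (z + i) != 0.
  by apply/prodf_neq0 => *; apply: qfact_neq0.
have AB_neq0 z k (c : 'I_k -> nat) : (forall i : 'I_k, (i < c i)%N) ->
    \prod_(i < k) qpoch (- q ^+ (2 * (z + i.+1))) (q ^+ 2) (c i - i.+1) != 0.
  move=> c_gt; have : \prod_(i < k) qfact q (z + (c i).-1) != 0.
    by apply/prodf_neq0 => *; apply: qfact_neq0.
  by rewrite prod_qfact_qpoch // mulf_eq0 negb_or => /andP[].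
(* By [PP_qfact] the q-factorials left over from [A] and [B] cancel against the product over all
   rows; [K] then cancels between [x] and [y]. *)
have dentE z : dent_factor z a b = A z * B z / (K * PP (q ^+ 2) z m n) / q ^ (z%:Z * S).
  rewrite /dent_factor !prod_source_factor sum_triangular.
  rewrite (prod_qfact_qpoch z a_gt) (prod_qfact_qpoch z b_gt).
  rewrite [\prod_(r < m + n) _](KP z).
  have -> : q ^ (z%:Z * S) = q ^+ (z * \sum_(i < m) a i) * q ^+ (z * \sum_(j < n) b j)
              / q ^+ (z * ((m + n) * (m + n + 1) %/ 2)).
    rewrite !exprnP invr_expz -!expfzDr //; congr (q ^ _).
    by rewrite /S !PoszM; ring.
  have := prod_neq0 z m; have := prod_neq0 z n; have := PP_neq0 z m n.
  rewrite -/(A z) -/(B z) => n1 n2 n3; field.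
  by rewrite n1 n2 n3 K_neq0 !expf_neq0.
rewrite !dentE !prodf_div -/(A x) -/(A y) -/(B x) -/(B y) -/S mulrBl expfzDr // -invr_expz.
have Ay : A y != 0 by apply: AB_neq0.
have By : B y != 0 by apply: AB_neq0.
by field; rewrite Ay By K_neq0 !PP_neq0 !expfz_neq0.
Qed.
End Ratio.

(** * Nonvanishing *)

(** Positivity at $X=Y=q=1$, stated through a numerator and a denominator so that evaluation makes
    sense. Unlike being nonzero, it survives sums, so weights of tilings cannot cancel. *)
Definition positive_at_one (f : ratfun) : Prop :=
  exists P Q : {mpoly rat[3]},
    [/\ 0 < meval (fun=> 1) P, 0 < meval (fun=> 1) Q
      & f = FracField.tofrac P / FracField.tofrac Q].

Lemma tofrac_neq0 (Q : {mpoly rat[3]}) : 0 < meval (fun=> 1) Q ->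
  FracField.tofrac Q != 0.
Proof. by rewrite tofrac_eq0; apply: contraTneq => ->; rewrite raddf0 ltxx. Qed.

Lemma positive_at_one_neq0 f : positive_at_one f -> f != 0.
Proof.
by case=> P [Q [P0 Q0 ->]]; rewrite mulf_neq0 ?invr_eq0 ?tofrac_neq0.
Qed.

Lemma positive_at_one_add f g :
  positive_at_one f -> positive_at_one g -> positive_at_one (f + g).
Proof.
move=> [P [Q [P0 Q0 ->]]] [P' [Q' [P'0 Q'0 ->]]].
exists (P * Q' + P' * Q), (Q * Q'); split.
- by rewrite rmorphD !rmorphM /= addr_gt0 // mulr_gt0.
- by rewrite rmorphM mulr_gt0.
- by rewrite addf_div ?tofrac_neq0 // rmorphD !rmorphM.
Qed.

Lemma positive_at_one_mul f g :
  positive_at_one f -> positive_at_one g -> positive_at_one (f * g).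
Proof.
move=> [P [Q [P0 Q0 ->]]] [P' [Q' [P'0 Q'0 ->]]].
exists (P * P'), (Q * Q'); split; rewrite ?rmorphM ?mulr_gt0 //.
by rewrite mulf_div.
Qed.

Lemma positive_at_one_inv f : positive_at_one f -> positive_at_one f^-1.
Proof. by move=> [P [Q [P0 Q0 ->]]]; exists Q, P; rewrite invf_div. Qed.

Lemma positive_at_one1 : positive_at_one 1.
Proof. by exists 1, 1; rewrite !rmorph1 divr1 ltr01. Qed.

Lemma positive_at_one_indet i : positive_at_one (indet i).
Proof.
by exists 'X_(inord i), 1; rewrite mevalXU rmorph1 /= rmorph1 divr1 ltr01.
Qed.

Lemma positive_at_one_expz f i : positive_at_one f -> positive_at_one (f ^ i).
Proof.
move=> f_pos; have f_exp k : positive_at_one (f ^+ k).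
  elim: k => [|k IHk]; first by rewrite expr0; apply: positive_at_one1.
  by rewrite exprS; apply: positive_at_one_mul.
by case: i => k; [apply: f_exp | apply/positive_at_one_inv/f_exp].
Qed.

Lemma positive_at_one_lozenge_weight x N (L : {set tri x N}) :
  positive_at_one (lozenge_weight Xvar Yvar qvar L).
Proof.
have pos_indet := positive_at_one_indet.
rewrite /lozenge_weight; case: pickP => [s _|_]; last exact: positive_at_one1.
apply: positive_at_one_mul; last first.
  by apply: positive_at_one_inv; apply: positive_at_one_add; apply: positive_at_one1.
by apply: positive_at_one_add; apply: positive_at_one_mul;
   [exact: pos_indet | apply/positive_at_one_expz/pos_indet
   | exact: pos_indet | apply/positive_at_one_expz/pos_indet].
Qed.

Lemma M_neq0 x N (R : {set tri x N}) : tileable R -> M Xvar Yvar qvar R != 0.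
Proof.
case/existsP=> P0 tilP0; apply: positive_at_one_neq0.
pose w (P : {set {set tri x N}}) := \prod_(L in P) lozenge_weight Xvar Yvar qvar L.
have pos_w P : positive_at_one (w P).
  apply: (big_ind positive_at_one); first exact: positive_at_one1.
    exact: positive_at_one_mul.
  by move=> L _; apply: positive_at_one_lozenge_weight.
rewrite /M (bigD1 P0) //= -/(w P0).
(* The alternative 0 covers the case where [P0] is the only tiling. *)
have [->|] : \sum_(P | tiling R P && (P != P0)) w P = 0
    \/ positive_at_one (\sum_(P | tiling R P && (P != P0)) w P).
- apply: (big_ind (fun f => f = 0 \/ positive_at_one f)); first by left.
    move=> f g [->|f_pos] [->|g_pos]; rewrite ?addr0 ?add0r; auto.
    by right; apply: positive_at_one_add.
  by move=> P _; right.
- by rewrite addr0.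
- exact: positive_at_one_add.
Qed.

Lemma qvar_neq0 : qvar != 0.
Proof. exact/positive_at_one_neq0/positive_at_one_indet. Qed.

Lemma qvar_free k : (0 < k)%N -> qvar ^+ k != 1.
Proof.
move=> k_gt0; apply/eqP; rewrite /qvar /indet -rmorphXn -(rmorph1 (@FracField.tofrac _)).
(* Evaluation at 2 turns the identity into $2^k = 1$, false for positive [k]. *)
move/eqP; rewrite tofrac_eq => /eqP /(congr1 (meval (fun=> 2%:R))).
rewrite rmorphXn /= mevalXU rmorph1 -natrX => /eqP; rewrite (eqr_nat _ _ 1).
by rewrite -{2}(expn0 2) eqn_exp2l // => /eqP E; rewrite E in k_gt0.
Qed.

(* The indices of [a] and [b] start at 0: the informal a_i is [a i] with
   [i.+1] in place of i. *)
Theorem theorem1p1 (x y m n : nat) (a : 'I_m -> nat) (b : 'I_n -> nat)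
  (a_range : forall i, (1 <= a i <= m + n)%N)
  (b_range : forall j, (1 <= b j <= m + n)%N)
  (a_incr : forall i i' : 'I_m, (i < i')%N -> (a i < a i')%N)
  (b_incr : forall j j' : 'I_n, (j < j')%N -> (b j < b j')%N)
  (x_tileable : tileable (region x a b)) :
  let q := qvar in
  M Xvar Yvar q (region x a b) / M Xvar Yvar q (region y a b) =
    q ^ ((y%:Z - x%:Z) *
         ((\sum_(i < m) a i)%N%:Z + (\sum_(j < n) b j)%N%:Z
          - ((m + n) * (m + n + 1) %/ 2)%N%:Z))
    * (PP (q ^+ 2) y m n / PP (q ^+ 2) x m n)
    * (\prod_(i < m)
         (qpoch (- q ^+ (2 * (x + i.+1))) (q ^+ 2) (a i - i.+1) /
          qpoch (- q ^+ (2 * (y + i.+1))) (q ^+ 2) (a i - i.+1)))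
    * (\prod_(j < n)
         (qpoch (- q ^+ (2 * (x + j.+1))) (q ^+ 2) (b j - j.+1) /
          qpoch (- q ^+ (2 * (y + j.+1))) (q ^+ 2) (b j - j.+1))).
Proof.
have q_neq0 := qvar_neq0; have q_free := qvar_free => q.
have [D MD] := M_region_factor Xvar Yvar q_neq0 q_free a_range b_range a_incr b_incr.
(* Tileability for [x] makes [D] nonzero, and the same [D] occurs for [y], so it cancels from the
   ratio. *)
have D_neq0 : D != 0.
  by have := M_neq0 x_tileable; rewrite MD mulf_eq0 negb_or => /andP[].
have a_gt := increasing_gt_index (fun i => proj1 (andP (a_range i))) a_incr.
have b_gt := increasing_gt_index (fun j => proj1 (andP (b_range j))) b_incr.
by rewrite !MD -mulf_div divff // mulr1; apply: dent_factor_ratio.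
Qed.
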